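(* If $n$ and $q$ are relatively prime integers, then $$\operatorname{sgn}^+_n(q)=\begin{cases}(-1)^{(q-1)/2}, & n\equiv 0 \pmod 4,\\ \left(\frac{q}{n}\right), & n\equiv 1,3\pmod 4,\\ 1, & n\equiv 2\pmod 4,\end{cases}$$ and $$\operatorname{sgn}^-_n(q)=\begin{cases}\left(\frac{n}{q}\right), & n\equiv 0\pmod 4,\\ \left(\frac{q}{n}\right), & n\equiv 1\pmod 4,\\ 1, & n\equiv 2,3\pmod 4.\end{cases}$$
   Context: For a finite set $X$, the sign $\operatorname{sgn}_X$ is the homomorphism from the symmetric group on $X$ to $\{\pm1\}$ that takes the value $-1$ at every transposition. For $\varepsilon\in\{1,-1\}$, multiplication by $\varepsilon$ generates a group $\langle\varepsilon\rangle$ acting on $\mathbb Z/n\mathbb Z$; write $\langle\varepsilon\rangle\backslash\mathbb Z/n\mathbb Z$ for its set of orbits (so for $\varepsilon=1$ this is $\mathbb Z/n\mathbb Z$ itself, and for $\varepsilon=-1$ it is $\mathbb Z/n\mathbb Z$ modulo $x\sim -x$). If $n$ and $q$ are relatively prime integers, multiplication by $q$ induces a permutation of $\langle\varepsilon\rangle\backslash\mathbb Z/n\mathbb Z$, and $\operatorname{sgn}^{+}_n(q)$ (for $\varepsilon=1$) and $\operatorname{sgn}^-_n(q)$ (for $\varepsilon=-1$) denote the sign of this permutation. $\left(\frac{a}{b}\right)$ is the Jacobi symbol for $b$ odd (equal to $1$ if $b=1$); for $b$ odd and negative it is read as $\left(\frac{a}{|b|}\right)$.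
   Formalization: n = 0 is excluded (the sign is undefined on an infinite set), and the formula for sgn^-_n(q) is stated only for n > 0, since it fails for negative n (n = -3, q = 2 gives 1 on the left and (2/3) = -1 on the right); replace n by |n| there. *)

(* Defs.v *)
From mathcomp Require Import all_boot all_order all_algebra all_fingroup.
Set Implicit Arguments.
Unset Strict Implicit.
Unset Printing Implicit Defensive.
Import GRing.Theory.
Local Open Scope ring_scope.

(* Z/nZ for n != 0, as the additive group of residues mod |n|. The library's
   'Z_k is avoided because 'Z_1 has two elements. For n = 0 this is a junk
   one-element type. *)
Notation Zmod n := 'I_(absz n).-1.+1.

Lemma Zmod_mulrz (n : int) (x : Zmod n) : x *~ n = 0.
Proof.
have main (k : nat) (y : 'I_k.-1.+1) : y *+ k = 0.
  case: k y => [|k] y //; apply: val_inj.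
  by rewrite Zp_mulrn /= modnMl.
case: n x => k x; first exact: main.
by have -> : x *~ Negz k = - (x *+ k.+1) by []; rewrite (main k.+1) oppr0.
Qed.

Lemma Zmod_mulrz_inj (n q : int) :
  coprimez n q -> injective (fun x : Zmod n => x *~ q).
Proof.
move=> /coprimezP[[u v] /= uv] x y /= exy.
have E (z : Zmod n) : z = z *~ q *~ v.
  rewrite -[LHS]mulr1z -uv mulrzDr [u * n]mulrC [v * q]mulrC !mulrzA.
  by rewrite Zmod_mulrz mul0rz add0r.
by rewrite (E x) exy -E.
Qed.

Definition mulperm (n q : int) (hq : coprimez n q) : {perm Zmod n} :=
  perm (Zmod_mulrz_inj hq).

Section Orbits.
Variables (n eps q : int) (heps : coprimez n eps) (hq : coprimez n q).

(* porbits s is the set of orbits of the group generated by s, so this is the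
   orbit set <eps>\Z/nZ. *)
Definition orbits : predArgType :=
  {O : {set Zmod n} | O \in porbits (mulperm heps)}.

Lemma mulperm_orbit (O : orbits) :
  mulperm hq @: val O \in porbits (mulperm heps).
Proof.
case: O => O /= /imsetP[x _ ->]; apply/imsetP; exists (mulperm hq x) => //.
set s := mulperm heps; set t := mulperm hq.
have st i z : t ((s ^+ i)%g z) = (s ^+ i)%g (t z).
  elim: i z => [|i IH] z; first by rewrite expg0 !perm1.
  by rewrite expgSr !permM -IH !permE /= mulrzAC.
apply/setP => y; apply/imsetP/porbitP => [[z /porbitP[i ->] ->]|[i ->]].
  by exists i.
by exists ((s ^+ i)%g x) => //; apply: mem_porbit.
Qed.

Definition mul_orbit (O : orbits) : orbits :=
  exist (fun A => A \in porbits (mulperm heps)) _ (mulperm_orbit O).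

Lemma mul_orbit_inj : injective mul_orbit.
Proof.
by move=> O O' /(congr1 val) /(imset_inj perm_inj) /val_inj.
Qed.

Definition orbit_perm : {perm orbits} := perm mul_orbit_inj.

Definition sgn_orbits : int := (-1) ^+ odd_perm orbit_perm.

End Orbits.

Lemma coprimez_1 (n : int) : coprimez n 1.
Proof. by rewrite /coprimez gcdz1. Qed.

Lemma coprimez_N1 (n : int) : coprimez n (-1).
Proof. by rewrite coprimezN coprimez_1. Qed.

Definition sgn_plus (n q : int) (hq : coprimez n q) : int :=
  sgn_orbits (coprimez_1 n) hq.

Definition sgn_minus (n q : int) (hq : coprimez n q) : int :=
  sgn_orbits (coprimez_N1 n) hq.

(* Legendre symbol (a/p), meant for p an odd prime. *)
Definition legendre (a : int) (p : nat) : int :=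
  if (p %| a)%Z then 0
  else if [exists x : 'I_p, ((x : int) ^+ 2 == a %[mod p])%Z] then 1
  else -1.

(* Jacobi symbol (a/|b|), meant for b odd; prime_decomp lists the pairs
   (prime, exponent), so the product is empty when |b| = 1. *)
Definition jacobi (a b : int) : int :=
  \prod_(f <- prime_decomp (absz b)) legendre a f.1 ^+ f.2.

(* Main.v *)
(* Let B be the matrix, indexed by the orbits of multiplication by eps on Z/nZ,
   with entries B(O, O') = \sum_(y in O') z ^+ (x * y), x in O, where z is a
   primitive n-th root of unity in a field of odd characteristic p not dividing
   n. Then B^2 is n times the permutation matrix of multiplication by -1, and the
   Frobenius permutes the columns of B as multiplication by p does. Taking
   determinants, the sign of p is the Legendre symbol mod p of (sign of -1) * n^N
   with N the number of orbits: N = n for eps = 1, N = n/2 + 1 for eps = -1.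
   Signs being multiplicative in q, this settles every odd q, and for n odd an
   even q may be replaced by q + n.

   For sgn^+ and n odd, that formula also shows that the sign is multiplicative
   in n, which reduces sgn^+_n(q) = (q/n) to Zolotarev's lemma for n prime; there
   the Vandermonde determinant of F_p gives the sign as q^((p-1)/2). So quadratic
   reciprocity is obtained rather than used. *)

Require Import Defs.
From mathcomp Require Import all_boot all_order all_algebra all_fingroup.
From mathcomp Require Import cyclic finfield zify ring.
Set Implicit Arguments.
Unset Strict Implicit.
Unset Printing Implicit Defensive.
Import GRing.Theory.
Local Open Scope ring_scope.

(** * Transport of permutation signs, and generators of finite fields *)

(** [odd_perm] is the parity of the number of points plus the number of cycles, and [f] carries
    cycles to cycles. *)
Lemma odd_perm_bij (T T' : finType) (f : T -> T') (s : {perm T})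
    (t : {perm T'}) :
  bijective f -> (forall x, f (s x) = t (f x)) -> odd_perm s = odd_perm t.
Proof.
move=> bijf fs; rewrite /odd_perm (bij_eq_card bijf); congr (_ (+) odd _).
have injf := bij_inj bijf.
have porb x : porbit t (f x) = f @: porbit s x.
  have fsX i y : f ((s ^+ i)%g y) = (t ^+ i)%g (f y).
    elim: i y => [|i IH] y; first by rewrite !expg0 !perm1.
    by rewrite !expgSr !permM fs IH.
  apply/setP=> y; apply/porbitP/imsetP => [[i ->]|[z /porbitP[i ->] ->]].
    by exists ((s ^+ i)%g x); rewrite ?mem_porbit.
  by exists i.
rewrite -(card_imset _ (imset_inj injf)).
apply: eq_card => A.
apply/imsetP/imsetP => [[B /imsetP[x _ ->] ->]|[x' _ ->]].
  by exists (f x); rewrite ?porb.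
case: bijf => g fK gK; exists (porbit s (g x')); first exact: imset_f.
by rewrite -porb gK.
Qed.

(** The nonzero elements are [#|F|.-1] distinct roots of unity of that exponent, which forces one of
    them to be primitive. *)
Lemma finField_prim_root (F : finFieldType) :
  exists z : F, #|F|.-1.-primitive_root z.
Proof.
have F1 := finNzRing_gt1 F.
have /hasP[z _ zP] : has #|F|.-1.-primitive_root (enum (predC1 (0 : F))).
  apply: has_prim_root; rewrite ?enum_uniq //; first by case: #|F| F1 => [|[]].
  - apply/allP=> x; rewrite mem_enum inE unity_rootE => x0.
    apply/eqP/(mulIf x0); rewrite mul1r -exprSr prednK ?(ltnW F1) //.
    exact: expf_card.
  - by rewrite -cardE cardC1.
by exists z.
Qed.

(** * The Legendre symbol and Euler's criterion *)

Section Legendre.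
Variables (p : nat) (p_pr : prime p) (p_odd : odd p).

Let half_pred : p.-1 = p./2.*2.
Proof. by move: p_odd (prime_gt1 p_pr); lia. Qed.

Lemma expr_pFp (x : 'F_p) : x ^+ p = x.
Proof. by have := expf_card x; rewrite card_Fp. Qed.

(** Euler's criterion, for any ring of characteristic [p], so that it serves both in ['F_p] and in
    extensions containing roots of unity. Equality of images of integers only depends on residues
    mod [p], so the proof takes place in ['F_p]. *)
Lemma legendre_euler (R : comNzRingType) (a : int) :
  p \in [pchar R] -> (legendre a p)%:~R = a%:~R ^+ p./2 :> R.
Proof.
move=> pR; apply/eqP; rewrite -rmorphXn -subr_eq0 -rmorphB -(dvdz_pcharf pR).
have pF := pchar_Fp p_pr.
rewrite (dvdz_pcharf pF) rmorphB subr_eq0 rmorphXn /=; apply/eqP.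
rewrite /legendre; case: ifPn => [|pa].
  rewrite (dvdz_pcharf pF) => /eqP->; rewrite expr0n.
  by case: (p./2) (prime_gt1 p_pr) half_pred => //; lia.
have a0 : a%:~R != 0 :> 'F_p by rewrite -(dvdz_pcharf pF).
have sqE (x : int) : (x ^+ 2 == a %[mod p])%Z = (x%:~R ^+ 2 == a%:~R :> 'F_p).
  by rewrite eqz_mod_dvd (dvdz_pcharf pF) rmorphB subr_eq0 rmorphXn.
have fermat (x : 'F_p) : x != 0 -> x ^+ p.-1 = 1.
  move=> x0; apply/(mulIf x0).
  by rewrite -exprSr prednK ?prime_gt0 // mul1r expr_pFp.
case: ifPn => [/existsP[x]|nsq].
  rewrite sqE => /eqP xa; rewrite -xa -exprM mul2n -half_pred fermat //.
  by apply: contraNneq a0 => x0; rewrite -xa x0 expr0n.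
have [g gP] := finField_prim_root 'F_p; rewrite card_Fp // in gP.
have [i ai] := prim_rootP gP (fermat _ a0).
have i_odd : odd i.
  apply: contraR nsq => i_even.
  have yp : (nat_of_ord (g ^+ i./2)%R < p)%N.
    by rewrite -[X in (_ < X)%N](Fp_cast p_pr) ltn_ord.
  apply/existsP; exists (Ordinal yp); rewrite sqE /= -[_%:~R]/((_ : nat)%:R).
  by rewrite natr_Zp -exprM muln2 even_halfK // ai.
rewrite ai -exprM mulnC exprM.
(* This power squares to 1 but is not 1, since [p./2] is less than the order [p.-1] of [g]; hence it
   is -1. *)
have /eqP : (g ^+ p./2) ^+ 2 = 1.
  by rewrite -exprM muln2 -half_pred; apply: prim_expr_order.
rewrite sqrf_eq1 => /orP[/eqP g1|/eqP->]; last by rewrite -signr_odd i_odd.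
have := prim_order_dvd gP p./2; rewrite g1 eqxx => /dvdn_leq.
by move: half_pred p_odd (prime_gt1 p_pr); lia.
Qed.

Lemma legendre_neq0 (a : int) :
  ~~ (p %| a)%Z -> legendre a p = 1 \/ legendre a p = -1.
Proof. by rewrite /legendre => /negPf->; case: ifP; [left|right]. Qed.

(** The difference has absolute value at most 2, which is less than [p]. Equalities of signs can
    thus be tested in characteristic [p]. *)
Lemma sign_pchar_inj (R : nzRingType) (a b : int) : p \in [pchar R] ->
  (absz a <= 1)%N -> (absz b <= 1)%N -> a%:~R = b%:~R :> R -> a = b.
Proof.
move=> pR a1 b1 /eqP; rewrite -subr_eq0 -rmorphB -(dvdz_pcharf pR) => pab.
have p2 : (2 < p)%N by move: p_odd (prime_gt1 p_pr); lia.
have {}pab : (p %| absz (a - b))%N by [].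
case: (posnP (absz (a - b))) => [|ab]; first lia.
by have := dvdn_leq ab pab; lia.
Qed.

Lemma absz_legendre (a : int) : (absz (legendre a p) <= 1)%N.
Proof. by rewrite /legendre; case: ifP => // _; case: ifP. Qed.

Lemma legendreM (a b : int) : legendre (a * b) p = legendre a p * legendre b p.
Proof.
apply: (sign_pchar_inj (pchar_Fp p_pr)); rewrite ?absz_legendre //.
  by rewrite abszM -[1%N]muln1 leq_mul ?absz_legendre.
by rewrite rmorphM /= !(legendre_euler _ (pchar_Fp p_pr)) rmorphM /= exprMn.
Qed.

Lemma legendre1 : legendre 1 p = 1.
Proof.
apply: (sign_pchar_inj (pchar_Fp p_pr)); rewrite ?absz_legendre //.
by rewrite !(legendre_euler _ (pchar_Fp p_pr)) expr1n.
Qed.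

Lemma legendreN1 : legendre (-1) p = (-1) ^+ p./2.
Proof.
apply: (sign_pchar_inj (pchar_Fp p_pr)); rewrite ?absz_legendre ?abszX ?exp1n //.
by rewrite !(legendre_euler _ (pchar_Fp p_pr)) !rmorphXn !rmorphN1.
Qed.

Lemma legendreX (a : int) k : legendre (a ^+ k) p = legendre a p ^+ k.
Proof.
by elim: k => [|k IH]; rewrite ?expr0 ?legendre1 // !exprS legendreM IH.
Qed.

Lemma legendre_sqr (a : int) : coprimez a p -> legendre a p ^+ 2 = 1.
Proof.
move=> ap; case: (@legendre_neq0 a) => [|->|->] //.
by move: ap; rewrite coprimez_sym coprimezE /= prime_coprime.
Qed.

End Legendre.

(** * Formal properties of signs on orbit sets *)

Section OrbitSigns.
Variables (n eps : int) (heps : coprimez n eps).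
Implicit Types (q : int) (O : orbits heps).

Lemma eq_sgn_orbits q q' (hq : coprimez n q) (hq' : coprimez n q') :
  (q = q' %[mod n])%Z -> sgn_orbits heps hq = sgn_orbits heps hq'.
Proof.
move=> qq'; rewrite /sgn_orbits; congr (_ ^+ odd_perm _).
apply/permP=> O; rewrite !permE; apply: val_inj; apply: eq_imset => x.
rewrite !permE (divz_eq q n) (divz_eq q' n) qq' !mulrzDr.
by rewrite ![_ * n]mulrC !mulrzA Zmod_mulrz !mul0rz.
Qed.

Lemma sgn_orbitsM q q' (hq : coprimez n q) (hq' : coprimez n q')
    (hqq' : coprimez n (q * q')) :
  sgn_orbits heps hqq' = sgn_orbits heps hq * sgn_orbits heps hq'.
Proof.
rewrite /sgn_orbits -signr_addb -odd_permM; congr (_ ^+ odd_perm _).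
apply/permP=> O; rewrite permM !permE; apply: val_inj; rewrite /= -imset_comp.
by apply: eq_imset => x; rewrite /= !permE /= mulrzA.
Qed.

Lemma sgn_orbits1 (h1 : coprimez n 1) : sgn_orbits heps h1 = 1.
Proof.
have /eqP := sgn_orbitsM h1 h1 h1; rewrite -{1}[sgn_orbits heps h1]mulr1.
rewrite -subr_eq0 -mulrBr mulf_eq0 {1}/sgn_orbits signr_eq0 /= subr_eq0.
by move/eqP.
Qed.

Lemma absz_sgn_orbits q (hq : coprimez n q) : absz (sgn_orbits heps hq) = 1%N.
Proof. by rewrite /sgn_orbits abszX exp1n. Qed.

Lemma orbit_subproof (x : Zmod n) :
  porbit (mulperm heps) x \in porbits (mulperm heps).
Proof. exact: imset_f. Qed.

Definition orbit_of (x : Zmod n) : orbits heps :=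
  exist (fun A => A \in porbits (mulperm heps)) _ (orbit_subproof x).

Lemma mem_orbit_of x : x \in val (orbit_of x).
Proof. exact: porbit_id. Qed.

Lemma orbit_ofP O x : x \in val O -> orbit_of x = O.
Proof.
case: O => A AP /= xA; apply: val_inj => /=.
by case/imsetP: AP xA => y _ -> xy; apply/eqP; rewrite eq_porbit_mem.
Qed.

Lemma orbit_of_surj O : {x | orbit_of x = O}.
Proof.
have : exists x, x \in val O.
  by case: O => A /= /imsetP[x _ ->]; exists x; apply: porbit_id.
by move=> h; exists (xchoose h); apply/orbit_ofP/(xchooseP h).
Qed.

Lemma mul_orbit_of q (hq : coprimez n q) x :
  mul_orbit hq (orbit_of x) = orbit_of (x *~ q).
Proof.
apply/esym/orbit_ofP/imsetP; exists x; first exact: mem_orbit_of.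
by rewrite permE.
Qed.

Lemma card_orbits : #|{: orbits heps}| = #|porbits (mulperm heps)|.
Proof. by rewrite card_sig; apply: eq_card. Qed.

Lemma sum_orbits (R : nmodType) (F : Zmod n -> R) :
  \sum_(O : orbits heps) \sum_(x in val O) F x = \sum_x F x.
Proof.
rewrite [RHS](partition_big orbit_of xpredT) //=; apply: eq_bigr => O _.
apply: eq_bigl => x; apply/idP/eqP => [/orbit_ofP //|<-].
exact: mem_orbit_of.
Qed.

End OrbitSigns.

(** Orbits are singletons when [eps] is 1, so that [sgn_plus] becomes the sign of a permutation of
    Z/nZ itself. *)
Lemma orbit_of_bij (n : int) : bijective (@orbit_of n 1 (coprimez_1 n)).
Proof.
have id1 : mulperm (coprimez_1 n) = 1%g by apply/permP=> x; rewrite !permE mulr1z.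
apply: inj_card_bij => [x y /(congr1 val) /= /eqP|].
  by rewrite eq_porbit_mem id1 => /porbitP[i]; rewrite expg1n perm1.
by rewrite card_orbits leq_imset_card.
Qed.

Lemma sgn_plusE (n q : int) (hq : coprimez n q) :
  sgn_plus hq = (-1) ^+ odd_perm (mulperm hq).
Proof.
rewrite /sgn_plus /sgn_orbits; congr (_ ^+ nat_of_bool _); apply/esym.
by apply: (odd_perm_bij (orbit_of_bij n)) => x; rewrite !permE mul_orbit_of.
Qed.

(** Opposite residues share an orbit, so -1 fixes every orbit. *)
Lemma sgn_minusN1 (n : int) (h : coprimez n (-1)) : sgn_minus h = 1.
Proof.
rewrite /sgn_minus /sgn_orbits; set s := orbit_perm _ _.
suff -> : s = 1%g by rewrite odd_perm1.
apply/permP=> O; rewrite perm1 permE; have [x <-] := orbit_of_surj O.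
rewrite mul_orbit_of; apply: orbit_ofP => /=; rewrite porbit_sym.
apply/porbitP; exists 1%N; rewrite expg1 permE.
by rewrite mulrN1z opprK.
Qed.

(** * Roots of unity in characteristic p and characters of Z/nZ *)

(** By Euler's theorem [n] divides p^phi(n) - 1, the order of the cyclic multiplicative group of the
    field with p^phi(n) elements. *)
Lemma pchar_prim_root (p n : nat) : prime p -> (0 < n)%N -> coprime n p ->
  {F : finFieldType & {z : F | p \in [pchar F] & n.-primitive_root z}}.
Proof.
move=> p_pr n_gt0 np.
have t_gt0 : (0 < totient n)%N by rewrite totient_gt0.
have [F pF cardF] := pPrimePowerField p_pr t_gt0; exists F.
have nF : (n %| #|F|.-1)%N.
  rewrite cardF -subn1 -eqn_mod_dvd ?expn_gt0 ?prime_gt0 //.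
  by apply/eqP/Euler_exp_totient; rewrite coprime_sym.
(* The conclusion is data, so the generator is found by a finite search; its mere existence only
   excludes failure. *)
have [z zP|noz] := pickP (fun z : F => #|F|.-1.-primitive_root z).
  by exists (z ^+ (#|F|.-1 %/ n)) => //; apply: dvdn_prim_root.
by exfalso; have [z] := finField_prim_root F; rewrite noz.
Qed.

Section Pairing.
Variables (k : nat) (F : fieldType) (z : F).
Hypothesis zP : k.+1.-primitive_root z.

(** The standard bicharacter putting Z/(k+1)Z in duality with itself. *)
Definition root_pairing (x y : 'I_k.+1) : F := z ^+ (x * y)%N.
Local Notation b := root_pairing.

Lemma root_pairingC x y : b x y = b y x.
Proof. by rewrite /b mulnC. Qed.

Lemma root_pairingD x y y' : b x (y + y') = b x y * b x y'.
Proof.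
by rewrite /b -exprD -mulnDr !(mulnC x) !exprM /= (prim_expr_mod zP).
Qed.

Lemma root_pairing0 x : b x 0 = 1.
Proof. by rewrite /b muln0 expr0. Qed.

Lemma root_pairing_nat x y m : b x (y *+ m) = b x y ^+ m.
Proof.
by elim: m => [|m IH]; rewrite ?root_pairing0 // mulrS root_pairingD IH exprS.
Qed.

(** Both sides are [b x y ^ q]. This self-adjointness moves a multiplication from an orbit to the
    point of evaluation. *)
Lemma root_pairing_int x y q : b (x *~ q) y = b x (y *~ q).
Proof.
have bN u v : b u (- v) = (b u v)^-1.
  have := root_pairingD u v (- v); rewrite subrr root_pairing0 => uv.
  have buv0 : b u v != 0.
    by apply/eqP => buv0; move/eqP: uv; rewrite buv0 mul0r oner_eq0.
  by rewrite -[RHS]mulr1 uv mulKf.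
have bz u v : b u (v *~ q) = b u v ^ q.
  case: q => m; first exact: root_pairing_nat.
  by rewrite [v *~ _]/(- (v *+ m.+1)) bN root_pairing_nat.
by rewrite root_pairingC !bz root_pairingC.
Qed.

(** Orthogonality of characters: for [x] nonzero this is a geometric sum of ratio [z ^+ x],
    different from 1, over a full period. *)
Lemma sum_root_pairing x : \sum_y b x y = if x == 0 then k.+1%:R else 0.
Proof.
case: eqP => [->|/eqP x0].
  rewrite (eq_bigr (fun=> 1)) => [|y _]; last by rewrite root_pairingC root_pairing0.
  by rewrite sumr_const card_ord.
have zx : z ^+ x - 1 != 0.
  rewrite subr_eq0 -(prim_order_dvd zP); apply: contra x0 => /dvdnP[m xm].
  apply/eqP/val_inj => /=; move: (ltn_ord x); rewrite xm.
  by case: m {xm} => // m; rewrite mulSn ltnNge leq_addr.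
apply: (mulfI zx); rewrite mulr0.
under eq_bigr do rewrite /b exprM.
by rewrite -subrX1 -exprM mulnC exprM (prim_expr_order zP) expr1n subrr.
Qed.

End Pairing.

(* The discrete Fourier transform on the orbits; [orbit_sum_const] makes the
   choice of representatives immaterial. *)
Section OrbitMatrix.
Variables (n eps : int) (heps : coprimez n eps) (F : fieldType) (z : F).
Hypothesis zP : (absz n).-1.+1.-primitive_root z.
Local Notation b := (root_pairing z).
Local Notation T := (orbits heps).

Definition orbit_sum (O : T) (x : Zmod n) := \sum_(y in val O) b x y.

Lemma orbit_sum_mul q (hq : coprimez n q) O x :
  orbit_sum (mul_orbit hq O) x = orbit_sum O (x *~ q).
Proof.
rewrite /orbit_sum /= big_imset /=; last by move=> ? ? _ _; apply: perm_inj.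
by apply: eq_bigr => y _; rewrite permE (root_pairing_int zP).
Qed.

(** Multiplication by [eps] fixes each orbit as a set, so by self-adjointness the sum is unchanged
    when [x] is multiplied by [eps]. *)
Lemma orbit_sum_const O x y :
  orbit_of heps x = orbit_of heps y -> orbit_sum O x = orbit_sum O y.
Proof.
have epsO (O' : T) : mul_orbit heps O' = O'.
  have [t <-] := orbit_of_surj O'; rewrite mul_orbit_of; apply: orbit_ofP.
  by rewrite /=; apply/porbitP; exists 1%N; rewrite expg1 permE.
move=> /(congr1 val) /eqP /=; rewrite eq_porbit_mem => /porbitP[i ->].
elim: i => [|i IH]; first by rewrite expg0 perm1.
by rewrite expgSr permM permE -orbit_sum_mul epsO.
Qed.

Definition orbit_rep (O : T) : Zmod n := sval (orbit_of_surj O).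

Lemma orbit_repK O : orbit_of heps (orbit_rep O) = O.
Proof. exact: svalP (orbit_of_surj O). Qed.

Definition orbit_mx : 'M[F]_#|{: T}| :=
  \matrix_(i, j) orbit_sum (enum_val j) (orbit_rep (enum_val i)).

Lemma rank_perm_inj (s : {perm T}) :
  injective (fun i : 'I_#|{: T}| => enum_rank (s (enum_val i))).
Proof. by move=> i j /enum_rank_inj /perm_inj /enum_val_inj. Qed.

Definition rank_perm s := perm (@rank_perm_inj s).

Lemma odd_rank_perm s : odd_perm (rank_perm s) = odd_perm s.
Proof.
apply/esym/(odd_perm_bij (f := enum_rank)); first exact: enum_rank_bij.
by move=> O; rewrite permE enum_rankK.
Qed.

(** Fourier inversion: transforming twice gives n times the reflection x -> -x. *)
Lemma orbit_mx_sqr (hN1 : coprimez n (-1)) :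
  orbit_mx *m orbit_mx =
    (absz n).-1.+1%:R *: perm_mx (rank_perm (orbit_perm heps hN1)).
Proof.
apply/matrixP=> i k; rewrite !mxE permE.
set x := orbit_rep (enum_val i).
(* The representative of orbit [j] in the second factor may be replaced by any member [y], which
   turns the double sum into a sum over all of Z/nZ. *)
have -> : \sum_j orbit_mx i j * orbit_mx j k
    = \sum_(O : T) \sum_(y in val O) b x y * orbit_sum (enum_val k) y.
  rewrite [RHS](reindex_onto enum_val enum_rank) => [|O _]; last exact: enum_rankK.
  rewrite [RHS](eq_bigl xpredT) => [|j]; last by rewrite enum_valK eqxx.
  apply: eq_bigr => j _; rewrite !mxE mulr_suml; apply: eq_bigr => y yj.
  congr (_ * _); apply: orbit_sum_const; rewrite orbit_repK.
  exact/esym/orbit_ofP.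
rewrite sum_orbits.
under eq_bigr do rewrite /orbit_sum mulr_sumr.
rewrite exchange_big /=.
have memNx : (- x \in val (enum_val k)) =
    (enum_rank (orbit_perm heps hN1 (enum_val i)) == k).
  rewrite -(can_eq enum_valK) enum_rankK permE -{1}(orbit_repK (enum_val i)).
  rewrite mul_orbit_of mulrN1z -/x; apply/idP/eqP => [/orbit_ofP //|<-].
  exact: mem_orbit_of.
(* With the middle variable summed first, orthogonality leaves only the term [y = - x]. *)
rewrite (eq_bigr (fun y => if x + y == 0 then (absz n).-1.+1%:R else 0)).
  rewrite -big_mkcondr -memNx.
  rewrite (eq_bigl (fun y => (y == - x) && (- x \in val (enum_val k)))).
    case: (_ \in _).
      by under eq_bigl do rewrite andbT; rewrite big_pred1_eq mulr1.
    by under eq_bigl do rewrite andbF; rewrite big_pred0_eq mulr0.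
  by move=> y; rewrite addrC addr_eq0 andbC; case: eqP => [->|].
move=> y _; rewrite -(sum_root_pairing zP); apply: eq_bigr => w _.
by rewrite root_pairingC -(root_pairingD zP) root_pairingC.
Qed.

Lemma det_orbit_mx_sqr (hN1 : coprimez n (-1)) : n != 0 ->
  \det orbit_mx ^+ 2 =
    (sgn_orbits heps hN1 * (absz n)%:Z ^+ #|{: T}|)%:~R.
Proof.
move=> n0; have nE : (absz n).-1.+1%:R = (absz n)%:R :> F.
  by rewrite prednK // absz_gt0.
rewrite expr2 -det_mulmx (orbit_mx_sqr hN1) detZ nE det_perm odd_rank_perm.
by rewrite rmorphM /= !rmorphXn /= rmorphN1 mulrC.
Qed.

Lemma det_orbit_mx_frobenius (p : nat) (hp : coprimez n p) :
  p \in [pchar F] ->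
  \det orbit_mx ^+ p = (sgn_orbits heps hp)%:~R * \det orbit_mx.
Proof.
move=> pF; rewrite -(pFrobenius_autE pF) -det_map_mx.
have -> : map_mx (pFrobenius_aut pF) orbit_mx
    = col_perm (rank_perm (orbit_perm heps hp)) orbit_mx.
  apply/matrixP=> i j; rewrite !mxE !permE enum_rankK orbit_sum_mul.
  rewrite rmorph_sum; apply: eq_bigr => y _ /=.
  by rewrite (root_pairing_int zP) (root_pairing_nat zP) pFrobenius_autE.
rewrite col_permE det_mulmx det_perm odd_permV odd_rank_perm mulrC.
by rewrite rmorphXn rmorphN1.
Qed.

End OrbitMatrix.

(** * The sign of an odd prime as a Legendre symbol *)

(** With s the sign and d the determinant, d^2 = D and d^p = s d give s = d^(p-1) = D^((p-1)/2), to
    which Euler's criterion applies; d is nonzero because [p] does not divide [n]. *)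
Lemma sgn_orbits_prime (n eps : int) (heps : coprimez n eps) (p : nat)
    (hp : coprimez n p) (hN1 : coprimez n (-1)) :
  prime p -> odd p -> n != 0 ->
  sgn_orbits heps hp =
    legendre (sgn_orbits heps hN1 * (absz n)%:Z ^+ #|{: orbits heps}|) p.
Proof.
move=> p_pr p_odd n0.
have nE : (absz n).-1.+1 = absz n by rewrite prednK // absz_gt0.
have np : coprime (absz n).-1.+1 p by rewrite nE.
have [F [z pF zP]] := pchar_prim_root p_pr (ltn0Sn _) np.
set D := (X in legendre X); pose d := \det (orbit_mx heps z).
have dD : d ^+ 2 = D%:~R by rewrite /d det_orbit_mx_sqr.
have D0 : D%:~R != 0 :> F.
  rewrite rmorphM !rmorphXn /= rmorphN1 mulf_neq0 ?signr_eq0 ?expf_neq0 //.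
  rewrite -[_%:~R]/((absz n)%:R) -(dvdn_pcharf pF) -prime_coprime //.
  by rewrite coprime_sym -nE.
have d0 : d != 0 by apply: contraNneq D0 => d0; rewrite -dD d0 expr0n.
apply: (sign_pchar_inj p_pr p_odd pF); rewrite ?absz_legendre ?absz_sgn_orbits //.
apply: (mulIf d0); rewrite -(det_orbit_mx_frobenius _ zP _ pF).
rewrite legendre_euler // -dD -exprM mul2n -exprSr; congr (_ ^+ _).
by move: p_odd; lia.
Qed.

(** * Orbits of negation, the sign of -1, and Zolotarev's lemma *)

Lemma card_neg_orbits (n : int) (h : coprimez n (-1)) :
  n != 0 -> #|porbits (mulperm h)| = (absz n)./2.+1.
Proof.
move=> n0; set s := mulperm h.
have nE : (absz n).-1.+1 = absz n by rewrite prednK // absz_gt0.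
have sE x : s x = - x by rewrite permE mulrN1z.
have val_opp (x : Zmod n) :
    nat_of_ord (- x) = if x == 0 then 0%N else ((absz n).-1.+1 - x)%N.
  have -> : nat_of_ord (- x) = (((absz n).-1.+1 - x) %% (absz n).-1.+1)%N by [].
  case: eqP => [->|/eqP x0]; first by rewrite subn0 modnn.
  by rewrite modn_small // ltn_subrL lt0n andbT;
    apply: contraNneq x0 => x0; apply/eqP/val_inj.
have mem_s x y : (y \in porbit s x) = (y == x) || (y == - x).
  apply/porbitP/orP => [[i ->]|[/eqP->|/eqP->]].
  - elim: i => [|i IH]; first by left; rewrite expg0 perm1.
    rewrite expgSr permM sE; case: IH => /eqP->; first by right.
    by left; rewrite opprK.
  - by exists 0%N; rewrite expg0 perm1.
  - by exists 1%N; rewrite expg1 sE.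
(* The residues from 0 to |n|/2, rounded down, represent each class under negation exactly once. *)
pose H : {set Zmod n} := [set x : Zmod n | (x < (absz n)./2.+1)%N].
have -> : porbits s = porbit s @: H.
  apply/setP=> A; apply/imsetP/imsetP => [[x _ ->]|[x _ ->]]; last by exists x.
  have [xH|xH] := boolP (x \in H); first by exists x.
  exists (- x); last by apply/eqP; rewrite eq_porbit_mem mem_s opprK eqxx orbT.
  move: xH; rewrite !inE val_opp; case: eqP => // _.
  by have := ltn_ord x; lia.
rewrite card_in_imset => [|x y]; last first.
  rewrite !inE => xH yH /eqP; rewrite eq_porbit_mem mem_s => /orP[/eqP //|/eqP xy].
  apply: val_inj => /=; move: (congr1 (@nat_of_ord _) xy) xH; rewrite val_opp.
  by case: eqP => [->|_] //; have := ltn_ord y; lia.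
have le_n : ((absz n)./2.+1 <= (absz n).-1.+1)%N.
  by rewrite nE; move: n0; rewrite -absz_gt0; lia.
have -> : H = widen_ord le_n @: setT.
  apply/setP=> x; rewrite inE; apply/idP/imsetP => [xH|[y _ ->]];
    last exact: (ltn_ord y).
  by exists (Ordinal xH) => //; apply: val_inj.
rewrite card_imset ?cardsT ?card_ord // => x y /(congr1 (@nat_of_ord _)) /= xy.
exact: val_inj.
Qed.

(** Negation has |n|/2 + 1 cycles, rounded down, on |n| points. *)
Lemma sgn_plusN1 (n : int) (h : coprimez n (-1)) :
  n != 0 -> sgn_plus h = (-1) ^+ (absz n).-1./2.
Proof.
move=> n0; rewrite sgn_plusE /odd_perm card_neg_orbits // card_ord.
rewrite prednK ?absz_gt0 // -[RHS]signr_odd; congr (_ ^+ nat_of_bool _).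
by move: n0; rewrite -absz_gt0; lia.
Qed.

(* Multiplication by q scales row i of the Vandermonde matrix on F_p by q ^ i,
   so its sign is q ^ 'C(p, 2) = q ^ ((p - 1) / 2) in F_p. *)
Lemma zolotarev (p : nat) (q : int) (hq : coprimez p q) :
  prime p -> odd p -> sgn_plus hq = legendre q p.
Proof.
move=> p_pr p_odd; have pF := pchar_Fp p_pr.
have pE : p.-1.+1 = p by rewrite prednK // prime_gt0.
have modnpE m : (m %% p.-1.+1 = m %% p)%N by rewrite pE.
(* [c] identifies the additive model [Zmod p] with the field ['F_p], which is a different type. *)
pose c (x : Zmod p) : 'F_p := (x : nat)%:R.
have cD x y : c (x + y) = c x + c y.
  rewrite /c -natrD -[RHS](Fp_nat_mod p_pr); congr (_%:R).
  exact: modnpE.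
have cMn x m : c (x *+ m) = c x *+ m.
  by elim: m => [|m IH]; rewrite ?mulr0n // !mulrS cD IH.
have cN x : c (- x) = - c x.
  by apply/eqP; rewrite -addr_eq0 -cD addNr.
have cz x : c (x *~ q) = q%:~R * c x.
  rewrite mulrzl; case: (q) => m; first exact: cMn.
  by rewrite [x *~ _]/(- (x *+ m.+1)) cN cMn.
pose V := Vandermonde p.-1.+1 (\row_i c i).
have V0 : \det V != 0.
  rewrite det_Vandermonde; apply/prodf_neq0 => i _; apply/prodf_neq0 => j ij.
  rewrite !mxE /c -natrB ?(ltnW ij) // -(dvdn_pcharf pF) gtnNdvd ?subn_gt0 //.
  by rewrite (leq_ltn_trans (leq_subr _ _)) // -[X in (_ < X)%N]pE ltn_ord.
have colV : col_perm (mulperm hq) V = diag_mx (\row_i q%:~R ^+ i) *m V.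
  by apply/matrixP=> i j; rewrite mul_diag_mx !mxE permE cz exprMn.
have := congr1 determinant colV.
rewrite col_permE det_mulmx det_perm odd_permV mulrC det_mulmx det_diag.
move=> /(mulIf V0) sE.
apply: (sign_pchar_inj p_pr p_odd pF); rewrite ?absz_legendre ?absz_sgn_orbits //.
rewrite sgn_plusE rmorphXn /= rmorphN1 sE (legendre_euler p_pr p_odd) //.
under eq_bigr do rewrite mxE.
(* For [p] odd the exponent is [p * p.-1./2], whose factor [p] disappears by Fermat. *)
rewrite prodrXr -(big_mkord xpredT id) bin2_sum pE bin2odd // exprM expr_pFp //.
by congr (_ ^+ _); move: p_odd; lia.
Qed.

(** * Inductions along prime factorizations, and powers of -1 *)

(** [P] relates the denominator to the value of the symbol, so that the induction follows the
    product defining [jacobi]. *)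
Lemma jacobi_ind (a : int) (P : nat -> int -> Prop) :
  P 1%N 1 -> (forall p, prime p -> odd p -> P p (legendre a p)) ->
  (forall m k x y, odd m -> odd k -> P m x -> P k y -> P (m * k)%N (x * y)) ->
  forall b : int, odd (absz b) -> P (absz b) (jacobi a b).
Proof.
move=> P1 Pp PM b b_odd; have b0 : (0 < absz b)%N by case: absz b_odd.
pose Q m x := odd m /\ P m x.
suff [] : Q (\prod_(f <- prime_decomp (absz b)) f.1 ^ f.2)%N (jacobi a b).
  by rewrite -prod_prime_decomp.
rewrite /jacobi big_seq [X in Q _ X]big_seq; apply: big_ind2 => //.
  move=> m x k y [mo Pm] [ko Pk]; split; first by rewrite oddM mo.
  exact: PM.
move=> [p e] /mem_prime_decomp[p_pr e_gt0].
move=> /(dvdn_trans (dvdn_exp e_gt0 (dvdnn p))) pb /=.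
have p_odd : odd p by apply: contraLR b_odd; rewrite -!dvdn2 => /dvdn_trans; apply.
elim: e {e_gt0} => [|e [IHo IH]]; first by rewrite expn0 expr0.
rewrite expnS exprS; split; first by rewrite oddM p_odd.
by apply: PM => //; apply: Pp.
Qed.

(** Odd integers are products of odd primes and a sign. *)
Lemma odd_int_ind (P : int -> Prop) : P 1 -> P (-1) ->
  (forall p : nat, prime p -> odd p -> P p) ->
  (forall a b, odd (absz a) -> odd (absz b) -> P a -> P b -> P (a * b)) ->
  forall q, odd (absz q) -> P q.
Proof.
move=> P1 PN1 Pp PM q q_odd.
have Pabs : P (absz q).
  (* Only the factorization of |q| is borrowed here; the numerator 0 is a dummy value. *)
  by apply: (@jacobi_ind 0 (fun m _ => P m)) => // m k _ _ *; rewrite PoszM; apply: PM.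
rewrite -[q]/(q : int) (intEsign q); apply: PM => //; last first.
  by case: (q < 0); rewrite ?expr0 ?expr1.
by rewrite abszX exp1n.
Qed.

(** The exponent (q - 1)/2 is negative for negative q; as -1 is its own inverse, only parity
    counts. *)
Lemma exprz_N1 (z : int) : (-1 : int) ^ z = (-1) ^+ odd (absz z).
Proof.
case: z => m; first by rewrite signr_odd.
by rewrite NegzE -exprnN -exprVn invrN1 abszN signr_odd.
Qed.

Lemma expr_odd_sqr1 (x : int) m : x ^+ 2 = 1 -> x ^+ m = x ^+ odd m.
Proof.
by move=> x2; rewrite -{1}(odd_double_half m) exprD -mul2n exprM x2 expr1n mulr1.
Qed.

(** For m = 2x + 1 and k = 2y + 1, half of mk - 1 is 2xy + x + y. *)
Lemma odd_half_predM (m k : nat) : odd m -> odd k ->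
  (-1) ^+ (m * k).-1./2 = (-1) ^+ m.-1./2 * (-1) ^+ k.-1./2 :> int.
Proof.
move=> mo ko; have -> : m = (m./2).*2.+1 by move: mo; lia.
have -> : k = (k./2).*2.+1 by move: ko; lia.
move: (m./2) (k./2) => x y.
have -> : (x.*2.+1 * y.*2.+1).-1./2 = ((x * y).*2 + (x + y))%N by nia.
by rewrite !exprD -mul2n exprM expr1n mul1r /= !doubleK.
Qed.

Lemma coprimez_even_odd (n q : int) :
  ~~ odd (absz n) -> coprimez n q -> odd (absz q).
Proof.
rewrite coprimezE -dvdn2 => n2 nq.
by rewrite -coprime2n; apply: coprime_dvdl nq.
Qed.

(** * Explicit signs of odd primes *)

Section PrimeFormulas.
Variables (n : int) (p : nat) (hp : coprimez n p).
Hypotheses (n0 : n != 0) (p_pr : prime p) (p_odd : odd p).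

Let legendre_n2 : legendre (absz n) p ^+ 2 = 1.
Proof. by apply: legendre_sqr; rewrite // coprimezE. Qed.

(** There are |n| orbits, and [legendre_n2] leaves only the parity of that exponent; the power of -1
    comes from [sgn_plusN1] and [legendreN1]. *)
Lemma sgn_plus_primeE :
  sgn_plus hp =
    (-1) ^+ ((absz n).-1./2 * p./2) * legendre (absz n) p ^+ odd (absz n).
Proof.
rewrite /sgn_plus (sgn_orbits_prime _ hp (coprimez_N1 n)) //.
rewrite -[sgn_orbits _ _]/(sgn_plus (coprimez_N1 n)) sgn_plusN1 //.
rewrite legendreM // !legendreX // legendreN1 // -exprM mulnC.
rewrite -(bij_eq_card (orbit_of_bij n)) card_ord prednK ?absz_gt0 //.
by rewrite (expr_odd_sqr1 _ legendre_n2).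
Qed.

(** Here -1 has sign 1, and the exponent is the parity of the number of orbits. *)
Lemma sgn_minus_primeE :
  sgn_minus hp = legendre (absz n) p ^+ odd (absz n)./2.+1.
Proof.
rewrite /sgn_minus (sgn_orbits_prime _ hp (coprimez_N1 n)) //.
rewrite -[sgn_orbits _ _]/(sgn_minus (coprimez_N1 n)) sgn_minusN1 mul1r.
by rewrite legendreX // (expr_odd_sqr1 _ legendre_n2) card_orbits card_neg_orbits.
Qed.

End PrimeFormulas.

(** * Evaluation of sgn^+ *)

Lemma odd_absz_neq0 (n : int) : odd (absz n) -> n != 0.
Proof. by apply: contraTneq => ->. Qed.

Lemma coprimez_addr (n q : int) : coprimez n q -> coprimez n (q + n).
Proof. by rewrite /coprimez gcdzDr. Qed.

Lemma eq_mod_addr (n q m : int) : (n %| m)%Z -> (q = q + m %[mod n])%Z.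
Proof. by move=> nm; apply/eqP; rewrite eq_sym eqz_mod_dvd addrC addKr. Qed.

(** All three signs are multiplicative in [q], so it suffices to treat -1 and odd primes, where the
    explicit formulas are multiplicative in the modulus. *)
Lemma sgn_plus_mull (n m k q : int) (hn : coprimez n q) (hm : coprimez m q)
    (hk : coprimez k q) :
  n = m * k -> odd (absz n) -> sgn_plus hn = sgn_plus hm * sgn_plus hk.
Proof.
move=> nE; rewrite nE in hn *; rewrite abszM oddM => /andP[mo ko].
have [m0 k0] := (odd_absz_neq0 mo, odd_absz_neq0 ko).
have odd_case r : odd (absz r) ->
    forall (hn : coprimez (m * k) r) (hm : coprimez m r) (hk : coprimez k r),
    sgn_plus hn = sgn_plus hm * sgn_plus hk.
  elim/odd_int_ind => [|| p p_pr p_odd | a b _ _ IHa IHb] {}hn {}hm {}hk.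
  - by rewrite /sgn_plus !sgn_orbits1.
  - by rewrite !sgn_plusN1 ?mulf_neq0 // abszM odd_half_predM.
  - rewrite !sgn_plus_primeE ?mulf_neq0 // abszM oddM mo ko PoszM legendreM //.
    by rewrite !exprM odd_half_predM // exprMn mulrACA.
  - have := hn; have := hm; have := hk; rewrite !coprimezMr.
    move=> /andP[hka hkb] /andP[hma hmb] /andP[hna hnb].
    rewrite /sgn_plus (sgn_orbitsM _ hna hnb) (sgn_orbitsM _ hma hmb).
    rewrite (sgn_orbitsM _ hka hkb) mulrACA.
    by congr (_ * _); [apply: IHa | apply: IHb].
have [qo|qo] := boolP (odd (absz q)); first exact: odd_case.
(* An even [q] is replaced by [q + m * k], which is odd and has the same residue for all three
   moduli. *)
have hn' := coprimez_addr hn; have := hn'; rewrite coprimezMl => /andP[hm' hk'].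
have shift r (h : coprimez r q) (h' : coprimez r (q + m * k)) :
    (r %| m * k)%Z -> sgn_plus h = sgn_plus h'.
  by move=> /(eq_mod_addr q); apply: eq_sgn_orbits.
rewrite (shift _ hn hn') // (shift _ hm hm') ?dvdz_mulr //.
rewrite (shift _ hk hk') ?dvdz_mull //; apply: odd_case.
have : odd (absz (m * k)) by rewrite abszM oddM mo.
by move: (m * k) qo => r; lia.
Qed.

Lemma sgn_plus_absz1 (n q : int) (h : coprimez n q) :
  absz n = 1%N -> sgn_plus h = 1.
Proof.
move=> n1; rewrite sgn_plusE; suff -> : mulperm h = 1%g by rewrite odd_perm1.
apply/permP=> x; apply: val_inj => /=.
by rewrite perm1; have := ltn_ord x; have := ltn_ord (mulperm h x); lia.
Qed.

(** Zolotarev's lemma treats prime moduli and [sgn_plus_mull] their products; a negative [n] is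
    split as -1 times |n|, the modulus -1 having trivial sign. *)
Lemma sgn_plus_odd (n q : int) (h : coprimez n q) :
  odd (absz n) -> sgn_plus h = jacobi q n.
Proof.
move=> no.
have absE : forall hN : coprimez (absz n) q, sgn_plus hN = jacobi q n.
  apply: (@jacobi_ind q (fun m x => odd m ->
    forall hN : coprimez m q, sgn_plus hN = x) _ _ _ n no no)
    => [_ hN | p p_pr _ p_odd hp | m k x y mo ko IHm IHk _ hN].
  - exact: sgn_plus_absz1.
  - exact: zolotarev.
  - have /andP[hm hk] : coprimez m q && coprimez k q by rewrite -coprimezMl -PoszM.
    rewrite -(IHm mo hm) -(IHk ko hk); apply: sgn_plus_mull => //.
    by rewrite /= oddM mo.
have habs : coprimez (absz n) q by rewrite coprimezE absz_id -coprimezE.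
have hs : coprimez ((-1) ^+ (n < 0)%R) q.
  by rewrite coprimezE abszX exp1n coprime1n.
rewrite (sgn_plus_mull h hs habs) ?absE //; last exact: intEsign.
by rewrite sgn_plus_absz1 ?mul1r // abszX exp1n.
Qed.

(** Both sides are multiplicative in odd [q]. For -1 and odd primes, [(absz n).-1./2] is odd and the
    Legendre factor has an even exponent. *)
Lemma sgn_plus_mod4_0 (n q : int) (h : coprimez n q) : n != 0 ->
  (n = 0 %[mod 4])%Z -> sgn_plus h = (-1) ^ ((q - 1) %/ 2)%Z.
Proof.
move=> n0 n4; have n_even : ~~ odd (absz n) by lia.
have qo := coprimez_even_odd n_even h; move: h.
elim/odd_int_ind: q / qo => [|| p p_pr p_odd | a b ao bo IHa IHb] h.
- by rewrite /sgn_plus sgn_orbits1.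
- rewrite sgn_plusN1 // exprz_N1 -signr_odd; congr (_ ^+ nat_of_bool _).
  by move: n0; rewrite -absz_gt0; lia.
- rewrite sgn_plus_primeE // (negPf n_even) mulr1 exprz_N1 -signr_odd oddM.
  congr (_ ^+ nat_of_bool _).
  by move: n0; rewrite -absz_gt0; lia.
- have := h; rewrite coprimezMr => /andP[ha hb].
  rewrite [LHS](sgn_orbitsM _ ha hb) [X in X * _](IHa ha) [X in _ * X](IHb hb).
  rewrite !exprz_N1 -signr_addb; congr (_ ^+ nat_of_bool _).
  have [u ->] : exists u, a = u * 2 + 1 by exists ((a - 1) %/ 2)%Z; lia.
  have [v ->] : exists v, b = v * 2 + 1 by exists ((b - 1) %/ 2)%Z; lia.
  have -> : (u * 2 + 1) * (v * 2 + 1) - 1 = (u * v * 2 + u + v) * 2 by ring.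
  by move: (u * v) => w; lia.
Qed.

(** Now [(absz n).-1./2] is even, so -1 and all odd primes have sign 1. *)
Lemma sgn_plus_mod4_2 (n q : int) (h : coprimez n q) :
  (n = 2 %[mod 4])%Z -> sgn_plus h = 1.
Proof.
move=> n4; have n_even : ~~ odd (absz n) by lia.
have n0 : n != 0 by lia.
have no : ~~ odd (absz n).-1./2 by lia.
have qo := coprimez_even_odd n_even h; move: h.
elim/odd_int_ind: q / qo => [|| p p_pr p_odd | a b ao bo IHa IHb] h.
- by rewrite /sgn_plus sgn_orbits1.
- by rewrite sgn_plusN1 // -signr_odd (negPf no).
- by rewrite sgn_plus_primeE // (negPf n_even) mulr1 -signr_odd oddM (negPf no).
- have := h; rewrite coprimezMr => /andP[ha hb].
  by rewrite [LHS](sgn_orbitsM _ ha hb) [X in X * _](IHa ha) [X in _ * X](IHb hb) mulr1.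
Qed.

(** * Evaluation of sgn^- *)

(** Since -1 has trivial sign, [q] may be made positive, as in the denominator of the Jacobi
    symbol. *)
Lemma sgn_minus_abs (n q : int) (h : coprimez n q) (h' : coprimez n (absz q)) :
  sgn_minus h = sgn_minus h'.
Proof.
have hs : coprimez n ((-1) ^+ (q < 0)%R).
  by rewrite coprimezE abszX exp1n coprimen1.
have sgn_s : sgn_minus hs = 1.
  by case: (q < 0)%R hs => hs; [exact: sgn_minusN1 | exact: sgn_orbits1].
have hsq : coprimez n ((-1) ^+ (q < 0)%R * (absz q)%:Z) by rewrite coprimezMr hs.
rewrite -[RHS]mul1r -sgn_s -(sgn_orbitsM _ hs h' hsq).
by apply: eq_sgn_orbits; rewrite -intEsign.
Qed.

(** The number |n|/2 + 1 of orbits is odd, so a prime p has sign (|n|/p), and |n| is [n] by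
    positivity. Multiplicativity in [q] does the rest. *)
Lemma sgn_minus_mod4 (n q : int) (h : coprimez n q) : 0 < n ->
  (n = 0 %[mod 4])%Z -> sgn_minus h = jacobi n q.
Proof.
move=> n_gt0 n4; have n_even : ~~ odd (absz n) by lia.
have h' : coprimez n (absz q) by rewrite coprimezE absz_id -coprimezE.
rewrite (sgn_minus_abs h h').
have nE : n = absz n by lia.
apply: (@jacobi_ind n (fun m x => forall hm : coprimez n m, sgn_minus hm = x)
  _ _ _ q _ h') => [hm | p p_pr p_odd hp | m k x y _ _ IHm IHk hmk | ].
- exact: sgn_orbits1.
- rewrite sgn_minus_primeE //; last by lia.
  rewrite -nE (_ : odd _ = true) ?expr1 //; lia.
- have /andP[hm hk] : coprimez n m && coprimez n k by rewrite -coprimezMr -PoszM.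
  rewrite -(IHm hm) -(IHk hk).
  have hmk' : coprimez n (m%:Z * k%:Z) by rewrite coprimezMr hm.
  rewrite -[RHS](sgn_orbitsM _ hm hk hmk').
  by apply: eq_sgn_orbits; rewrite PoszM.
- exact: coprimez_even_odd n_even h.
Qed.

(** The number of orbits is even, so the Legendre symbols occur to even powers. For positive [n] the
    parity condition means that [n] is 2 or 3 mod 4. *)
Lemma sgn_minus_trivial (n q : int) (h : coprimez n q) : n != 0 ->
  odd (absz n)./2 -> sgn_minus h = 1.
Proof.
move=> n0 no.
have odd_case r : odd (absz r) -> forall hr : coprimez n r, sgn_minus hr = 1.
  elim/odd_int_ind => [|| p p_pr p_odd | a b ao bo IHa IHb] hr.
  - exact: sgn_orbits1.
  - exact: sgn_minusN1.
  - by rewrite sgn_minus_primeE //= no.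
  - have := hr; rewrite coprimezMr => /andP[ha hb].
    by rewrite [LHS](sgn_orbitsM _ ha hb) [X in X * _]IHa [X in _ * X]IHb mulr1.
have [qo|qo] := boolP (odd (absz q)); first exact: odd_case.
have h' := coprimez_addr h.
have -> : sgn_minus h = sgn_minus h'.
  by apply: eq_sgn_orbits; apply: eq_mod_addr.
(* For [q] even, coprimality makes [n] odd, hence [q + n] odd. *)
apply: odd_case; have [ne|] := boolP (odd (absz n)); first lia.
by move=> /coprimez_even_odd /(_ h); rewrite (negPf qo).
Qed.

(** In this residue class [(absz n).-1./2] is even and [(absz n)./2.+1] is odd, so both signs are
    (|n|/p) at an odd prime p and 1 at -1. *)
Lemma sgn_minus_plus (n q : int) (h : coprimez n q) :
  (absz n = 1 %[mod 4])%N -> sgn_minus h = sgn_plus h.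
Proof.
move=> n1; have no : odd (absz n) by lia.
have n0 := odd_absz_neq0 no.
have odd_case r : odd (absz r) ->
    forall hr : coprimez n r, sgn_minus hr = sgn_plus hr.
  elim/odd_int_ind => [|| p p_pr p_odd | a b ao bo IHa IHb] hr.
  - by rewrite /sgn_minus /sgn_plus !sgn_orbits1.
  - rewrite sgn_minusN1 sgn_plusN1 // -signr_odd (_ : odd _ = false) //; lia.
  - rewrite sgn_minus_primeE // sgn_plus_primeE // no -signr_odd oddM.
    rewrite (_ : odd _.-1./2 = false) ?mul1r; last lia.
    by rewrite (_ : odd _ = true) //; lia.
  - have := hr; rewrite coprimezMr => /andP[ha hb].
    rewrite /sgn_minus /sgn_plus !(sgn_orbitsM _ ha hb).
    by congr (_ * _); [apply: IHa | apply: IHb].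
have [qo|qo] := boolP (odd (absz q)); first exact: odd_case.
have h' := coprimez_addr h.
have hh' eps (heps : coprimez n eps) : sgn_orbits heps h = sgn_orbits heps h'.
  by apply: eq_sgn_orbits; apply: eq_mod_addr.
rewrite /sgn_minus /sgn_plus !hh'.
by apply: odd_case; lia.
Qed.

Theorem proposition2p1p5 (n q : int) (n0 : n != 0) (nq : coprimez n q) :
  [/\ (n = 0 %[mod 4])%Z -> sgn_plus nq = (-1) ^ ((q - 1) %/ 2)%Z,
      (n = 1 %[mod 4])%Z \/ (n = 3 %[mod 4])%Z -> sgn_plus nq = jacobi q n
    & (n = 2 %[mod 4])%Z -> sgn_plus nq = 1] /\
  (0 < n ->
  [/\ (n = 0 %[mod 4])%Z -> sgn_minus nq = jacobi n q,
      (n = 1 %[mod 4])%Z -> sgn_minus nq = jacobi q n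
    & (n = 2 %[mod 4])%Z \/ (n = 3 %[mod 4])%Z -> sgn_minus nq = 1]).
Proof.
split=> [|n_gt0]; split=> n4.
- exact: sgn_plus_mod4_0.
- by apply: sgn_plus_odd; lia.
- exact: sgn_plus_mod4_2.
- exact: sgn_minus_mod4.
- by rewrite sgn_minus_plus ?sgn_plus_odd //; lia.
- by apply: sgn_minus_trivial => //; lia.
Qed.
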